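(* Let $N>2$, $m\in(0,m_c)$ with $m_c=\frac{N-2}{N}$, $\sigma>-2$ and $p>m$ with $L:=\sigma(m-1)+2(p-1)\neq 0$, and let $u=u(r,t)$ be a (classical for $r\in(0,\infty)$) solution to the equation $$u_t=(u^m)_{rr}+\frac{N-1}{r}(u^m)_r+r^{\sigma}u^p .$$ Then the function $\overline{u}(\overline{r},t)$ given by $$\overline{u}(\overline{r},t)=\frac{1}{C_1}\,r^{(N-2)/m}\,u(r,t),\qquad C_1=\left[\frac{4m^2}{(mN-N+2)^2}\right]^{\sigma/L},$$ $$\overline{r}=C_2r^{\theta},\qquad C_2=C_1^{-(p-1)/\sigma},\qquad \theta=\frac{mN-N+2}{2m},$$ is a solution to the same equation with independent variable $\overline{r}$ (and the same $m$, $p$), that is, $$\overline{u}_t=(\overline{u}^m)_{\overline{r}\,\overline{r}}+\frac{\overline{N}-1}{\overline{r}}(\overline{u}^m)_{\overline{r}}+\overline{r}^{\,\overline{\sigma}}\,\overline{u}^p ,$$ with parameters given by $$\overline{N}=-\frac{2(N-2m-2)}{mN-N+2},\qquad \overline{\sigma}=-\frac{2[(N-2)(p-1)-m\sigma]}{mN-N+2}.$$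
   Context: The equation is the radial form, with $r=|x|$, of the fast diffusion equation with spatially inhomogeneous source $\partial_t u=\Delta u^m+|x|^{\sigma}u^p$, posed for $t\in(0,T)$ with some $T>0$. The dimension $N$ (and likewise $\overline{N}$) is regarded as a real parameter, since it only appears as a coefficient in the radial equation.
   Formalization: The printed constants fail unless p=1 or θ²=1; the formal statement replaces r by r/C₂: r̄=(r/C₂)^θ, ū=(1/C₁)(r/C₂)^{(N-2)/m}u, with C₁, C₂, θ as printed; at σ=0, C₂ is read as [4m²/(mN-N+2)²]^{-(p-1)/L}. *)

(* Defs.v *)
From HB Require Import structures.
From mathcomp Require Import all_boot all_order all_algebra.
From mathcomp Require Import all_classical all_reals all_analysis.
From mathcomp Require Import ring lra.

Set Implicit Arguments.
Unset Strict Implicit.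
Unset Printing Implicit Defensive.

Import Order.TTheory GRing.Theory Num.Theory numFieldNormedType.Exports.

Local Open Scope classical_set_scope.
Local Open Scope ring_scope.

(* Functions of the radius r and the time t are curried, radius first. *)
Section Equation.
Context {R : realType}.
Implicit Types (f u : R -> R -> R).

Definition d_t f (r t : R) : R := derive1 (f r) t.
Definition d_r f (r t : R) : R := derive1 (fun s => f s t) r.

Definition continuous2_at f (r t : R) : Prop :=
  {for (r, t), continuous (fun z : R * R => f z.1 z.2)}.

(* Nonnegativity is what gives u^m and u^p their meaning for real exponents
   (the library's powR satisfies 0 `^ a = 0 for a != 0).  Positivity is not
   required.  The dimension N is any real number. *)
Record classical_solution (N m p sigma T : R) u : Prop := {
  cs_ge0 : forall r t, 0 < r -> 0 < t < T -> 0 <= u r t;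
  cs_cont : forall r t, 0 < r -> 0 < t < T -> continuous2_at u r t;
  cs_t : forall r t, 0 < r -> 0 < t < T ->
    derivable (u r) t 1 /\ continuous2_at (d_t u) r t;
  cs_r : forall r t, 0 < r -> 0 < t < T ->
    derivable (fun s => u s t `^ m) r 1 /\
    continuous2_at (d_r (fun s t => u s t `^ m)) r t;
  cs_rr : forall r t, 0 < r -> 0 < t < T ->
    derivable (fun s => d_r (fun s t => u s t `^ m) s t) r 1 /\
    continuous2_at (d_r (d_r (fun s t => u s t `^ m))) r t;
  cs_eq : forall r t, 0 < r -> 0 < t < T ->
    d_t u r t = d_r (d_r (fun s t => u s t `^ m)) r t
                + (N - 1) / r * d_r (fun s t => u s t `^ m) r t
                + r `^ sigma * u r t `^ p
}.

End Equation.

Section Constants.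
Context {R : realType}.
Implicit Types N m p sigma : R.

Definition m_c N : R := (N - 2) / N.

Definition L m p sigma : R := sigma * (m - 1) + 2 * (p - 1).

Definition theta N m : R := (m * N - N + 2) / (2 * m).

Definition C1 N m p sigma : R :=
  (4 * m ^+ 2 / (m * N - N + 2) ^+ 2) `^ (sigma / L m p sigma).

(* C2 = C1 `^ (- (p - 1) / sigma) when sigma != 0, see C2E; this form is the
   one that also covers sigma = 0. *)
Definition C2 N m p sigma : R :=
  (4 * m ^+ 2 / (m * N - N + 2) ^+ 2) `^ (- (p - 1) / L m p sigma).

Lemma C2E N m p sigma : sigma != 0 ->
  C2 N m p sigma = C1 N m p sigma `^ (- (p - 1) / sigma).
Proof.
move=> s0; rewrite /C2 /C1 -powRrM; congr (_ `^ _).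
by rewrite [RHS]mulrC mulrA divfK.
Qed.

Definition Nbar N m : R := - (2 * (N - 2 * m - 2)) / (m * N - N + 2).

Definition sigmabar N m p sigma : R :=
  - (2 * ((N - 2) * (p - 1) - m * sigma)) / (m * N - N + 2).

End Constants.

(* C2 is a unit for r, that is r = C2 * rbar `^ (theta^-1), and
   ubar = C1^-1 * rbar `^ ((N - 2) / (m * theta)) * u.  It cannot be moved to
   the other side as rbar = C2 * r `^ theta: for rbar = b * r `^ theta and
   ubar = a^-1 * r `^ ((N - 2) / m) * u, matching the coefficients of the
   diffusion and of the source term forces a `^ (m - 1) * b ^+ 2 = theta ^- 2
   and b `^ sigmabar = a `^ (p - 1), whose solution is
   a = C1 * C2 `^ ((N - 2) / m), b = C2 `^ (- theta), not a = C1, b = C2.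
   The relation determines ubar on rbar > 0, since r |-> (r / C2) `^ theta is a
   bijection of the positive half-line; other values of ubar are irrelevant. *)
Definition transformed {R : realType} (N m p sigma T : R)
    (u ubar : R -> R -> R) : Prop :=
  forall r t : R, 0 < r -> 0 < t < T ->
    ubar ((r / C2 N m p sigma) `^ theta N m) t
    = 1 / C1 N m p sigma * (r / C2 N m p sigma) `^ ((N - 2) / m) * u r t.

(* Main.v *)
Require Import Defs.
From mathcomp Require Import all_boot all_order all_algebra.
From mathcomp Require Import all_classical all_reals all_analysis.
From mathcomp Require Import ring lra.
Import Order.TTheory GRing.Theory Num.Theory numFieldNormedType.Exports.
Local Open Scope ring_scope.

(** Write [w = u^m], [b = 1 / theta], [k = (N - 2) b], so that on the
    half-line [ubar^m] is a multiple of [y^k w(c y^b, t)], with [c = C2].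
    The radial Laplacian in dimension [Nbar] of the latter has three terms; as
    [k + Nbar = 2] the one in [w] drops out, and the two others recombine into
    [c^2 b^2 y^(k + 2b - 2)] times the radial Laplacian of [w] in dimension
    [N].  The equation for [u] then gives the one for [ubar] because the powers
    of [y] agree and [C1], [C2] solve
    [C1^(m-1) theta^2 = C2^2], [C1^(p-1) C2^sigma = 1]. *)

(** * Locality of derivatives and continuity on the open domain *)

Lemma near_domain2 (R : realType) (T r t : R) : 0 < r -> 0 < t < T ->
  \forall z \near (r, t), 0 < z.1 /\ 0 < z.2 < T.
Proof.
move=> r0 /andP[t0 tT]; near=> z; split; last (apply/andP; split).
- by near: z; exact: (cvg_fst (lt_nbhsr r0)).
- by near: z; exact: (cvg_snd (lt_nbhsr t0)).
- by near: z; exact: (cvg_snd (lt_nbhsl tT)).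
Unshelve. all: by end_near. Qed.

Section EqualOnDomain.
Context {R : realType}.
Variables (T : R) (f g : R -> R -> R).
Hypothesis fg : forall r t, 0 < r -> 0 < t < T -> f r t = g r t.

Lemma near_domain_r (r t : R) : 0 < r -> 0 < t < T ->
  \forall s \near r, f s t = g s t.
Proof.
move=> r0 tT; near=> s; apply: fg => //.
by near: s; exact: lt_nbhsr.
Unshelve. all: by end_near. Qed.

Lemma near_domain_t (r t : R) : 0 < r -> 0 < t < T ->
  \forall s \near t, f r s = g r s.
Proof.
move=> r0 /andP[t0 tT]; near=> s; apply: fg => //; apply/andP; split.
- by near: s; exact: lt_nbhsr.
- by near: s; exact: lt_nbhsl.
Unshelve. all: by end_near. Qed.

Lemma d_r_eq (r t : R) : 0 < r -> 0 < t < T -> d_r f r t = d_r g r t.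
Proof.
move=> r0 tT; rewrite /d_r !derive1E.
by apply: near_eq_derive; exact: near_domain_r.
Qed.

Lemma derivable_r_eq (r t : R) : 0 < r -> 0 < t < T ->
  derivable (g ^~ t) r 1 -> derivable (f ^~ t) r 1.
Proof.
move=> r0 tT; apply: near_eq_derivable.
by apply: filterS (near_domain_r r t r0 tT) => s ->.
Qed.

Lemma d_t_eq (r t : R) : 0 < r -> 0 < t < T -> d_t f r t = d_t g r t.
Proof.
move=> r0 tT; rewrite /d_t !derive1E.
by apply: near_eq_derive; exact: near_domain_t.
Qed.

Lemma derivable_t_eq (r t : R) : 0 < r -> 0 < t < T ->
  derivable (g r) t 1 -> derivable (f r) t 1.
Proof.
move=> r0 tT; apply: near_eq_derivable.
by apply: filterS (near_domain_t r t r0 tT) => s ->.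
Qed.

Lemma continuous2_at_eq (r t : R) : 0 < r -> 0 < t < T ->
  continuous2_at g r t -> continuous2_at f r t.
Proof.
move=> r0 tT cg.
suff : (f z.1 z.2 @[z --> (r, t)] --> g r t)%classic.
  by rewrite /continuous2_at /prop_for /continuous_at /= fg.
apply: cvg_trans cg; apply: near_eq_cvg.
by apply: filterS (near_domain2 R T r t r0 tT) => z [? ?]; rewrite fg.
Qed.

End EqualOnDomain.

Section Continuous2.
Context {R : realType}.
Implicit Types (f g : R -> R -> R) (k r t : R).

Lemma continuous2_atD f g r t : continuous2_at f r t ->
  continuous2_at g r t -> continuous2_at (fun r t => f r t + g r t) r t.
Proof. by move=> cf cg; exact: cvgD. Qed.

Lemma continuous2_atZ k f r t : continuous2_at f r t ->
  continuous2_at (fun r t => k * f r t) r t.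
Proof. by move=> cf; apply: cvgM cf; exact: cvg_cst. Qed.

End Continuous2.

(** * The power substitution in the radius *)

Section Pull.
Context {R : realType}.
Variables (c b : R).
Implicit Types (e r t : R) (f : R -> R -> R).

(** Up to constant factors, the transformed solution, its [m]-th power and its time derivative are
    all of this form; the exponent [e] records the power of [r] in front. *)
Definition pull e f r t : R := r `^ e * f (c * r `^ b) t.

Lemma mulr_powR_gt0 r : 0 < c -> 0 < r -> 0 < c * r `^ b.
Proof. by move=> c0 r0; rewrite mulr_gt0// powR_gt0. Qed.

Lemma continuous_powR e r : 0 < r -> {for r, continuous (fun s => s `^ e)}.
Proof.
move=> r0; apply/differentiable_continuous/derivable1_diffP.
by have [] := is_derive1_powR e r0.
Qed.

Lemma continuous2_pull e f r t : 0 < r ->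
  continuous2_at f (c * r `^ b) t -> continuous2_at (pull e f) r t.
Proof.
move=> r0 cf.
have cP a : (z.1 `^ a @[z --> (r, t)] --> r `^ a)%classic.
  by apply: (cvg_comp fst (fun s => s `^ a) cvg_fst); exact: continuous_powR.
have gP : ((c * z.1 `^ b, z.2) @[z --> (r, t)] --> (c * r `^ b, t))%classic.
  exact: cvg_pair (cvgM (cvg_cst c) (cP b)) cvg_snd.
exact: cvgM (cP e) (cvg_comp _ _ gP cf).
Qed.

Lemma is_derive_pull_t e f r t : derivable (f (c * r `^ b)) t 1 ->
  is_derive t 1 (pull e f r) (pull e (d_t f) r t).
Proof.
move=> /derivableP; rewrite -derive1E => df.
exact: (is_deriveZ (r `^ e) df).
Qed.

(** Product and chain rule. The result is again a combination of pulls, so a second application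
    gives the second derivative. *)
Lemma is_derive_pull_r e f r t : 0 < r -> derivable (f ^~ t) (c * r `^ b) 1 ->
  is_derive r 1 (pull e f ^~ t)
    (e * pull (e - 1) f r t + c * b * pull (e + b - 1) (d_r f) r t).
Proof.
move=> r0 /derivableP; rewrite -derive1E -/(d_r f _ t) => df.
have dg := is_deriveZ c (is_derive1_powR b r0).
have dh := @is_derive1_comp _ (f ^~ t) (c \*: (fun s => s `^ b)) _ _ _ df dg.
apply: is_derive_eq (is_deriveM (is_derive1_powR e r0) dh) _.
rewrite /pull /=.
have -> : r `^ (e + b - 1) = r `^ e * r `^ (b - 1).
  by rewrite -addrA; apply: powRD; rewrite (gt_eqF r0) implybT.
by rewrite /GRing.scale /=; ring.
Qed.

End Pull.

(* [powR] sends negative reals to [1], so it is only one-sidedly continuous at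
   [0]. *)
Lemma cvg_powR (R : realType) (S : Type) (F : set_system S) (f : S -> R)
    (l m : R) : Filter F -> 0 < m -> 0 <= l -> (\forall x \near F, 0 <= f x) ->
  (f x @[x --> F] --> l)%classic -> (f x `^ m @[x --> F] --> l `^ m)%classic.
Proof.
move=> FF m0; rewrite le_eqVlt => /predU1P[<-|l0] f0 fl.
- rewrite powR0 ?gt_eqF//; apply/cvgr0Pnorm_lt => eps eps0.
  (* As [m > 0], the power is increasing on nonnegative reals, so the threshold for [f] is the
     [m]-th root of [eps]. *)
  have d0 : 0 < eps `^ m^-1 by rewrite powR_gt0.
  near=> x.
  have fx0 : 0 <= f x by near: x.
  rewrite ger0_norm ?powR_ge0//.
  have -> : eps = (eps `^ m^-1) `^ m.
    by rewrite -powRrM mulVf ?gt_eqF// powRr1// ltW.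
  apply: gt0_ltr_powR; rewrite ?nnegrE// ?powR_ge0//.
  rewrite -[f x]ger0_norm//.
  by near: x; move/cvgr0Pnorm_lt : fl; exact.
- by apply: (cvg_comp f (fun s => s `^ m) fl); exact: continuous_powR.
Unshelve. all: by end_near. Qed.

(** * Transport of solutions *)

(** The domain is open, so derivatives and limits at its points see only values taken nearby inside
    it. This lets [ubar] be replaced by an explicit formula, which [transformed] gives on the domain
    alone. *)
Lemma classical_solution_eq (R : realType) (N m p sigma T : R)
    (u v : R -> R -> R) :
  (forall r t : R, 0 < r -> 0 < t < T -> u r t = v r t) ->
  classical_solution N m p sigma T v -> classical_solution N m p sigma T u.
Proof.
move=> uv [v0 vc vt vr vrr veq].
pose um r t := u r t `^ m; pose vm r t := v r t `^ m.
have uvm (r t : R) : 0 < r -> 0 < t < T -> um r t = vm r t.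
  by move=> r0 tT; rewrite /um uv.
have uvmr := d_r_eq T _ _ uvm; have uvmrr := d_r_eq T _ _ uvmr.
have uvt := d_t_eq T _ _ uv.
split=> r t r0 tT.
- by rewrite uv ?v0.
- by apply: (continuous2_at_eq T _ _ uv) => //; exact: vc.
- have [dv cv] := vt _ _ r0 tT; split.
  + exact: (derivable_t_eq T u v uv r t r0 tT dv).
  + exact: (continuous2_at_eq T _ _ uvt r t r0 tT cv).
- have [dv cv] := vr _ _ r0 tT; split.
  + exact: (derivable_r_eq T um vm uvm r t r0 tT dv).
  + exact: (continuous2_at_eq T _ _ uvmr r t r0 tT cv).
- have [dv cv] := vrr _ _ r0 tT; split.
  + exact: (derivable_r_eq T (d_r um) (d_r vm) uvmr r t r0 tT dv).
  + exact: (continuous2_at_eq T _ _ uvmrr r t r0 tT cv).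
- rewrite -/(um) -/(d_r um r t).
  rewrite (uvt r t r0 tT) (uvmrr r t r0 tT) (uvmr r t r0 tT) (uv r t r0 tT).
  exact: veq.
Qed.

(** The conditions on the parameters come from comparing coefficients. [m * e + N' = 2] cancels the
    term in [u^m], and [m * e = (N - 2) * b] then fixes the one in its first derivative. The other
    four match the power of [r] and the constant factor, once between the time derivative and the
    diffusion, once in the source. *)
Lemma classical_solution_pull (R : realType) (N N' m p sigma sigma' T : R)
    (a b c e : R) (u : R -> R -> R) :
  0 < m -> 0 < a -> 0 < c ->
  m * e = (N - 2) * b -> m * e + N' = 2 -> e = m * e + 2 * b - 2 ->
  a = a `^ m * (c * b) ^+ 2 ->
  a * c `^ sigma = a `^ p -> e + b * sigma = sigma' + e * p ->
  classical_solution N m p sigma T u ->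
  classical_solution N' m p sigma' T (fun r t => a * pull c b e u r t).
Proof.
move=> m0 a0 c0 ke kN' e2 am ap es [u0 uc ut ur urr ueq].
set k := m * e in ke kN' e2.
pose w r t := u r t `^ m.
pose P := pull c b.
pose v r t := a * P e u r t.
pose vm r t := v r t `^ m.
(* [W], [W1] and [W2] are [vm] and its first two radial derivatives on the domain, left in the
   unsimplified shape that [is_derive_pull_r] produces. *)
pose W r t := a `^ m * P k w r t.
pose W1 r t := a `^ m * (k * P (k - 1) w r t +
  c * b * P (k + b - 1) (d_r w) r t).
pose W2 r t := a `^ m * (k * ((k - 1) * P (k - 1 - 1) w r t +
    c * b * P (k - 1 + b - 1) (d_r w) r t) +
  c * b * ((k + b - 1) * P (k + b - 1 - 1) (d_r w) r t +
    c * b * P (k + b - 1 + b - 1) (d_r (d_r w)) r t)).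
have vmE (r t : R) : 0 < r -> 0 < t < T -> vm r t = W r t.
  move=> r0 tT; have x0 := mulr_powR_gt0 c b r c0 r0.
  rewrite /vm /v /W /P /pull powRM ?(ltW a0) ?mulr_ge0 ?powR_ge0 ?u0//.
  by rewrite powRM ?powR_ge0 ?u0// -powRrM [e * m]mulrC.
have dW (r t : R) : 0 < r -> 0 < t < T -> is_derive r 1 (W ^~ t) (W1 r t).
  move=> r0 tT; have x0 := mulr_powR_gt0 c b r c0 r0.
  have [dw _] := ur _ _ x0 tT.
  exact: is_deriveZ (is_derive_pull_r c b k w r t r0 dw).
have dW1 (r t : R) : 0 < r -> 0 < t < T -> is_derive r 1 (W1 ^~ t) (W2 r t).
  move=> r0 tT; have x0 := mulr_powR_gt0 c b r c0 r0.
  have [dw _] := ur _ _ x0 tT; have [dw1 _] := urr _ _ x0 tT.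
  apply: is_deriveZ; apply: is_deriveD; apply: is_deriveZ.
  - exact: (is_derive_pull_r c b (k - 1) w r t r0 dw).
  - exact: (is_derive_pull_r c b (k + b - 1) (d_r w) r t r0 dw1).
have vm1 (r t : R) : 0 < r -> 0 < t < T -> d_r vm r t = W1 r t.
  move=> r0 tT; rewrite (d_r_eq T _ _ vmE)// /d_r derive1E.
  by have [_ ->] := dW r t r0 tT.
have vm2 (r t : R) : 0 < r -> 0 < t < T -> d_r (d_r vm) r t = W2 r t.
  move=> r0 tT; rewrite (d_r_eq T _ _ vm1)// /d_r derive1E.
  by have [_ ->] := dW1 r t r0 tT.
have dv (r t : R) : 0 < r -> 0 < t < T ->
    is_derive t 1 (v r) (a * P e (d_t u) r t).
  move=> r0 tT; have x0 := mulr_powR_gt0 c b r c0 r0.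
  have [du _] := ut _ _ x0 tT.
  exact: is_deriveZ (is_derive_pull_t c b e u r t du).
have vt (r t : R) : 0 < r -> 0 < t < T -> d_t v r t = a * P e (d_t u) r t.
  move=> r0 tT; rewrite /d_t derive1E.
  by have [_ ->] := dv r t r0 tT.
(* [u] may vanish, so continuity of its [m]-th power needs [cvg_powR]. *)
have cw (r t : R) : 0 < r -> 0 < t < T -> continuous2_at w r t.
  move=> r0 tT; apply: (cvg_powR _ _ _ _ _ _ _ m0 _ _ (uc r t r0 tT)) => //.
    exact: u0.
  by apply: filterS (near_domain2 R T r t r0 tT) => z [? ?]; exact: u0.
split=> r t r0 tT; have x0 := mulr_powR_gt0 c b r c0 r0;
  have u0x := u0 _ _ x0 tT; have wx := cw _ _ x0 tT;
  have ucx := uc _ _ x0 tT; have [_ utc] := ut _ _ x0 tT;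
  have [dw wc] := ur _ _ x0 tT; have [dw1 w1c] := urr _ _ x0 tT;
  have Pw q := continuous2_pull c b q w r t r0 wx;
  have Pw1 q := continuous2_pull c b q (d_r w) r t r0 wc;
  have Pw2 q := continuous2_pull c b q (d_r (d_r w)) r t r0 w1c.
- by rewrite !mulr_ge0 ?powR_ge0 ?(ltW a0).
- by apply: continuous2_atZ; exact: continuous2_pull.
- split; first by have [] := dv r t r0 tT.
  apply: (continuous2_at_eq T _ _ vt) => //.
  by apply: continuous2_atZ; exact: continuous2_pull.
- split.
    have [dWr _] := dW r t r0 tT.
    exact: (derivable_r_eq T vm W vmE r t r0 tT dWr).
  apply: (continuous2_at_eq T _ _ vm1) => //.
  by apply/continuous2_atZ/continuous2_atD; apply/continuous2_atZ.
- split.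
    have [dWr _] := dW1 r t r0 tT.
    exact: (derivable_r_eq T (d_r vm) W1 vm1 r t r0 tT dWr).
  apply: (continuous2_at_eq T _ _ vm2) => //.
  by apply/continuous2_atZ/continuous2_atD; apply/continuous2_atZ;
    apply/continuous2_atD; apply/continuous2_atZ.
- rewrite -/vm (vt r t r0 tT) (vm2 r t r0 tT) (vm1 r t r0 tT).
  rewrite /W1 /W2 /v /P /pull (ueq _ _ x0 tT) -/w.
  have pD s1 s2 : r `^ (s1 + s2) = r `^ s1 * r `^ s2.
    by apply: powRD; rewrite (gt_eqF r0) implybT.
  have pB s : r `^ (s - 1) = r `^ s / r.
    rewrite powRB; last by rewrite (gt_eqF r0) implybT.
    by rewrite powRr1 ?ltW.
  (* Both source terms are brought to the form power of [r], constant, [u^p]; then [es] and [ap]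
     make them equal. *)
  have -> : r `^ e * (d_r (d_r w) (c * r `^ b) t +
      (N - 1) / (c * r `^ b) * d_r w (c * r `^ b) t +
      (c * r `^ b) `^ sigma * u (c * r `^ b) t `^ p) =
      r `^ e * (d_r (d_r w) (c * r `^ b) t +
      (N - 1) / (c * r `^ b) * d_r w (c * r `^ b) t) +
      r `^ (e + b * sigma) * c `^ sigma * u (c * r `^ b) t `^ p.
    by rewrite powRM ?powR_ge0 ?(ltW c0)// pD powRrM; ring.
  have -> : r `^ sigma' * (a * (r `^ e * u (c * r `^ b) t)) `^ p =
      r `^ (sigma' + e * p) * a `^ p * u (c * r `^ b) t `^ p.
    rewrite powRM ?mulr_ge0 ?powR_ge0 ?(ltW a0)//.
    by rewrite powRM ?powR_ge0// pD powRrM; ring.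
  rewrite es -ap {1}e2.
  (* All powers are split into [r^k], [r^b] and integer powers of [r], so that what remains is a
     rational identity. *)
  have -> : r `^ (k + 2 * b - 2) = r `^ k * (r `^ b) ^+ 2 / r ^+ 2.
    have -> : k + 2 * b - 2 = k + b + b - 1 - 1 by ring.
    by rewrite !pB !pD; field; rewrite gt_eqF.
  have -> : k - 1 + b - 1 = k + b - 1 - 1 by ring.
  have -> : k + b - 1 + b - 1 = k + b + b - 1 - 1 by ring.
  rewrite !pB !pD.
  have -> : N' = 2 - k by rewrite -kN'; ring.
  rewrite mulrDr mulrA [a * _ * (_ + _)]mulrC {1}am.
  have Y0 : 0 < r `^ b by rewrite powR_gt0.
  move: (r `^ b) (r `^ k) Y0 x0 => Y Q Y0 x0.
  move: (d_r _ _ _) (d_r _ _ _) (w _ _) => w1 w2 w0.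
  rewrite ke; field.
  by rewrite !gt_eqF.
Qed.

(** * The constants of the transformation *)

Theorem theorem1p1 (R : realType) (N m p sigma T : R) (u ubar : R -> R -> R)
    (hN : 2 < N) (hm0 : 0 < m) (hmc : m < m_c N) (hsigma : -2 < sigma)
    (hp : m < p) (hL : L m p sigma != 0) (hT : 0 < T)
    (hu : classical_solution N m p sigma T u)
    (hubar : transformed N m p sigma T u ubar) :
  classical_solution (Nbar N m) m p (sigmabar N m p sigma) T ubar.
Proof.
have D0 : m * N - N + 2 < 0.
  move: hmc; rewrite /m_c ltr_pdivlMr; last by lra.
  by lra.
have m0 : m != 0 by rewrite gt_eqF.
have Dn0 : m * N - N + 2 != 0 by rewrite lt_eqF.
(* [K] is [theta^-2]. Both [C1] and [C2] are powers of it, so conditions on them become identities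
   between exponents. *)
set K := 4 * m ^+ 2 / (m * N - N + 2) ^+ 2.
have K0 : 0 < K.
  apply: divr_gt0; first by rewrite mulr_gt0 ?exprn_gt0.
  by rewrite exprn_even_gt0.
set th := theta N m.
have th0 : th != 0.
  by rewrite /th /theta mulf_neq0// invr_neq0// mulf_neq0// pnatr_eq0.
set c := C2 N m p sigma.
have c0 : 0 < c by exact: powR_gt0.
pose a := K `^ (- (sigma / L m p sigma)).
have aE : 1 / C1 N m p sigma = a by rewrite div1r /a powRN.
have KD s1 s2 : K `^ s1 * K `^ s2 = K `^ (s1 + s2).
  by apply/esym/powRD; rewrite (gt_eqF K0) implybT.
pose e := (N - 2) / m * th^-1.
apply: (classical_solution_eq R _ _ _ _ _ _
  (fun r t => a * pull c th^-1 e u r t)).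
  move=> y t y0 tT.
  (* The radius is chosen so that [(r / c)^theta = y]. *)
  have := hubar (c * y `^ th^-1) t (mulr_powR_gt0 _ _ _ c0 y0) tT.
  rewrite -/c -/th aE [c * _]mulrC mulfK ?gt_eqF// -!powRrM mulVf//.
  rewrite powRr1 ?ltW// => ->.
  by rewrite /pull /e [th^-1 * _]mulrC [c * _]mulrC mulrA.
apply: (classical_solution_pull R N _ m p sigma _ T a th^-1 c e) => //.
- exact: powR_gt0.
- by rewrite /e; field; rewrite ?th0 ?m0 ?Dn0.
- by rewrite /e /th /theta /Nbar; field; rewrite ?th0 ?m0 ?Dn0.
- by rewrite /e /th /theta; field; rewrite ?th0 ?m0 ?Dn0.
- have -> : (c * th^-1) ^+ 2 = c ^+ 2 * K.
    by rewrite /K /th /theta; field; rewrite ?th0 ?m0 ?Dn0.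
  (* After clearing denominators, the exponents of [K] agree by the definition of [L]. *)
  rewrite -powR_mulrn ?(ltW c0)// /a /c /C2 -/K -!powRrM.
  rewrite -[X in _ * (_ * X)]powRr1 ?(ltW K0)// !KD; congr (_ `^ _).
  move: hL; rewrite /L => hL; field; exact: hL.
- rewrite /a /c /C2 -/K -!powRrM KD; congr (_ `^ _).
  by field.
- by rewrite /e /th /theta /sigmabar; field; rewrite ?th0 ?m0 ?Dn0.
Qed.
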